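(* Let $\boldsymbol{k}=(k_1,\dots,k_r)$ be an index and let $\mathcal L=\{s\in\mathbb C:|\operatorname{Re}(s)|<\tfrac12\}$. Then, as $N\to\infty$, $$\mathcal T_N(\boldsymbol{k};s)=\mathcal T_*^{T_N}(\boldsymbol{k};s)+O_{\boldsymbol{k},K}\left(\frac{(1+\log N)^{r-1}}{N}\right)$$ uniformly for $s$ in every compact subset $K\subset\mathcal L\setminus\{0\}$.
   Context: An index is a finite sequence $\boldsymbol{k}=(k_1,\dots,k_r)$ of positive integers, of depth $r$ and weight $|\boldsymbol{k}|=k_1+\cdots+k_r$; the empty index is $\varnothing$ (weight $0$). Reversal: $\overleftarrow{\boldsymbol{k}}=(k_r,\dots,k_1)$. Write $\boldsymbol{k}_{[1,j]}=(k_1,\dots,k_j)$, $\boldsymbol{k}_{(j,r]}=(k_{j+1},\dots,k_r)$, $\boldsymbol{k}_{[1,j)}=(k_1,\dots,k_{j-1})$, with $\boldsymbol{k}_{[1,0]}=\boldsymbol{k}_{(r,r]}=\boldsymbol{k}_{[1,1)}=\varnothing$. An index is admissible if it is empty or its last entry is $\geqslant2$. For $s\in\mathbb C\setminus\mathbb Z$ and $N\geqslant1$, $\mathcal T_N(\boldsymbol{k};s)=\sum_{-N<n_1<\cdots<n_r<N}\prod_{i=1}^r(n_i+s)^{-k_i}$, and $T_N=\sum_{n=1}^{N-1}\frac1n$. Stuffle regularization. For a nonempty admissible index $\boldsymbol{a}=(a_1,\dots,a_d)$, $\zeta(\boldsymbol{a};s)=\sum_{0<n_1<\cdots<n_d}\prod_{i}(n_i+s)^{-a_i}$,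 and $\zeta(\varnothing;s)=1$. On the $\mathbb Q$-span $\mathfrak H^1_*$ of all indices, the stuffle product $*$ is bilinear with unit $\varnothing$ and $(a,\boldsymbol{\alpha})*(b,\boldsymbol{\beta})=(a,\boldsymbol{\alpha}*(b,\boldsymbol{\beta}))+(b,(a,\boldsymbol{\alpha})*\boldsymbol{\beta})+(a+b,\boldsymbol{\alpha}*\boldsymbol{\beta})$; $\mathfrak H^0_*$ is the span of admissible indices. It is known that every index of depth $r$ has a unique decomposition $\boldsymbol{k}=\sum_{l=0}^r\boldsymbol{u}_l*(1)^{*l}$ with $\boldsymbol{u}_l\in\mathfrak H^0_*$, where every index occurring in $\boldsymbol{u}_l$ has depth at most $r-l$. Define $\zeta_*^X(\boldsymbol{k};s)=\sum_{l=0}^r\zeta(\boldsymbol{u}_l;s)X^l$ (with $\zeta(\cdot;s)$ extended linearly); equivalently, $\zeta_*^X(\cdot;s)$ is the unique stuffle homomorphism extending $\zeta(\cdot;s)$ on admissible indices with $\zeta_*^X(1;s)=X$. Harmonic number function: $H(s)=\int_0^1\frac{1-t^s}{1-t}\,dt=\psi(1+s)+\gamma=\sum_{n\geqslant1}\bigl(\frac1n-\frac1{n+s}\bigr)$, extended meromorphically to $\mathbb C$. Regularized multitangent function: $$\mathcal T_*^T(\boldsymbol{k};s)=\sum_{j=0}^{r}(-1)^{|\boldsymbol{k}_{[1,j]}|}\zeta_*^{T-H(-s)}(\overleftarrow{\boldsymbol{k}_{[1,j]}};-s)\,\zeta_*^{T-H(s)}(\boldsymbol{k}_{(j,r]};s)+\sum_{j=1}^{r}\frac{(-1)^{|\boldsymbol{k}_{[1,j)}|}}{s^{k_j}}\zeta_*^{T-H(-s)}(\overleftarrow{\boldsymbol{k}_{[1,j)}};-s)\,\zeta_*^{T-H(s)}(\boldsymbol{k}_{(j,r]};s),$$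 with empty-index factors equal to $1$. *)

(* Defs.v *)
From HB Require Import structures.
From mathcomp Require Import all_boot all_order all_algebra.
From mathcomp Require Import complex freeg.
From mathcomp Require Import all_classical all_reals all_analysis.
Set Implicit Arguments.
Unset Strict Implicit.
Unset Printing Implicit Defensive.
Import Order.TTheory GRing.Theory Num.Theory.
Import numFieldNormedType.Exports.
Local Open Scope ring_scope.
Local Open Scope classical_set_scope.
Local Open Scope complex_scope.

(* Numeric fields carry the topology of their norm, but R[i] is not
   syntactically the carrier of an abstract numFieldType: transfer the
   topology of the complex modulus to it. *)
HB.instance Definition _ (R : realType) :=
  NormedModule.copy R[i] (Num.NumField.sort (R[i] : numFieldType)).

Definition is_index (k : seq nat) : bool := all (leq 1) k.

Definition weight (k : seq nat) : nat := sumn k.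

Definition admissible (k : seq nat) : bool :=
  is_index k && ((k == [::]) || (1 < last 0 k)%N).

(* Formal rational combinations of words. The span of the indices consists of
   the elements supported on words satisfying is_index. *)
Notation word_span := {freeg (seq nat) / rat}.

Definition prefix_word (a : nat) (D : word_span) : word_span :=
  fglift (fun w : seq nat => << a :: w >> : word_span) D.

Fixpoint stuffle_word (k : seq nat) : seq nat -> word_span :=
  match k with
  | [::] => fun l => << l >>
  | a :: k' =>
    fix stuffle_k (l : seq nat) : word_span :=
      match l with
      | [::] => << a :: k' >>
      | b :: l' => prefix_word a (stuffle_word k' (b :: l'))
                   + prefix_word b (stuffle_k l')
                   + prefix_word (a + b)%N (stuffle_word k' l')
      end
  end.

Definition stuffle (D E : word_span) : word_span :=
  fglift (fun k => fglift (stuffle_word k) E) D.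

Definition stuffle_pow (D : word_span) (l : nat) : word_span :=
  iter l (stuffle D) << [::] >>.

(* k = \sum_(l <= r) u_l * (1)^{*l}, where each u_l is a combination of
   admissible indices of depth at most r - l. *)
Definition is_stuffle_decomp (k : seq nat)
    (u : {ffun 'I_(size k).+1 -> word_span}) : Prop :=
  (forall (l : 'I_(size k).+1) (w : seq nat), w \in dom (u l) ->
     admissible w /\ (size w <= size k - l)%N) /\
  << k >> = \sum_(l < (size k).+1) stuffle (u l) (stuffle_pow << [:: 1%N] >> l).

(* The decomposition exists and is unique for every index, so the default value
   0 of xget is never used there. *)
Definition stuffle_decomp (k : seq nat) : {ffun 'I_(size k).+1 -> word_span} :=
  xget [ffun => 0] [set u | is_stuffle_decomp u].
Arguments stuffle_decomp : clear implicits.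

Section Functions.
Variable R : realType.
Implicit Types (k : seq nat) (s X : R[i]).

(* Sum over lo <= m_1 < ... < m_r < lo + M, with m_i = lo + n_i. *)
Definition nested_sum (lo : int) (M : nat) k s : R[i] :=
  \sum_(n : (size k).-tuple 'I_M | sorted ltn [seq val i | i <- n])
    \prod_(i < size k)
      (((lo + (tnth n i : nat)%:Z)%:~R + s) ^+ nth 0%N k i)^-1.

Definition multitangent (N : nat) k s : R[i] :=
  nested_sum (1 - N%:Z) (N.*2).-1 k s.

Definition harmonic_sum (N : nat) : R[i] := \sum_(1 <= n < N) n%:R^-1.

(* The nested series, as the limit of its truncations to indices n_i < N. *)
Definition zeta (a : seq nat) s : R[i] :=
  limn (fun N : nat => nested_sum 1 N.-1 a s).

Definition zeta_lin (D : word_span) s : R[i] :=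
  \sum_(a <- dom D) ratr (coeff a D) * zeta a s.

Definition zeta_reg k X s : R[i] :=
  \sum_(l < (size k).+1) zeta_lin (stuffle_decomp k l) s * X ^+ l.

Definition harmonic_fun s : R[i] :=
  limn (fun N : nat => \sum_(1 <= n < N) (n%:R^-1 - (n%:R + s)^-1)).

(* In the second sum j is shifted to start at 0. *)
Definition reg_multitangent k (T : R[i]) s : R[i] :=
  \sum_(j < (size k).+1)
    (-1) ^+ weight (take j k)
    * zeta_reg (rev (take j k)) (T - harmonic_fun (- s)) (- s)
    * zeta_reg (drop j k) (T - harmonic_fun s) s
  + \sum_(j < size k)
    (-1) ^+ weight (take j k) / s ^+ nth 0%N k j
    * zeta_reg (rev (take j k)) (T - harmonic_fun (- s)) (- s)
    * zeta_reg (drop j.+1 k) (T - harmonic_fun s) s.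

Definition strip : set R[i] := [set s | `|complex.Re s| < 2^-1].

End Functions.
Arguments harmonic_sum : clear implicits.
Arguments strip : clear implicits.

(* Main.v *)
Require Import Defs.
From HB Require Import structures.
From mathcomp Require Import all_boot all_order all_algebra.
From mathcomp Require Import complex freeg.
From mathcomp Require Import all_classical all_reals all_analysis.
From mathcomp Require Import zify ring lra.
Import Order.TTheory GRing.Theory Num.Theory.
Import numFieldNormedType.Exports.
Local Open Scope ring_scope.
Local Open Scope classical_set_scope.
Local Open Scope complex_scope.
Set Implicit Arguments.
Unset Strict Implicit.
Unset Printing Implicit Defensive.

(** Write Z_N(k; s) for the sum over 0 < n_1 < ... < n_r < N that truncates
    zeta(k; s), L_N = 1 + log N and T_N for the harmonic sum.

    Everything is compared at the finite level.  The sum over -N < n_1 < ... <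
    n_r < N splits according to how many indices are negative and whether one
    of them is 0; reversing the negative block turns it into a truncated zeta
    value at -s, so that the multitangent sum is given exactly by the formula
    that defines the regularized multitangent function, with the regularized
    zeta values replaced by Z_N (multitangent_cut).  It remains to show that
      zeta_*^(T_N - H(s))(k; s) = Z_N(k; s) + O(L_N^(r-1) / N),
    because Z_N(k; s) = O(L_N^r) lets such approximations be multiplied.

    The regularized value is defined through a decomposition
    k = sum_l u_l * (1)^l with u_l admissible of depth at most r - l.  For
    fixed s the map Z_N(. ; s) is a stuffle homomorphism (nsum_stuffle), so
    the same decomposition gives Z_N(k) = sum_l Z_N(u_l) Z_N(1)^l, and the
    comparison reduces to two cases (log_small_zeta_reg):
    - Z_N(1; s) = T_N - H(s) + O(1/N), the tail of the series for H
      (log_small_harmonic);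
    - Z_N(a; s) = zeta(a; s) + O(L_N^(d-1) / N) for a admissible of depth d,
      because the last summation variable n carries an exponent at least 2 and
      the other ones contribute at most L_n^(d-1) (log_small_zeta).
    Such a decomposition exists by induction on the number t of trailing ones:
    (a, 1^(t-1)) * (1) is t times (a, 1^t) plus words with fewer trailing ones
    (stuffle_word1, decomposable_index).

    Uniformity: in the strip |n + s| >= n / 2 for every n >= 1, so that the
    constants depend on K only through the bounds delta <= |s| <= B, which
    hold on a compact set that avoids 0. *)

(** * Nested sums over intervals of integers *)

Section NestedSums.
Context (C : comNzRingType).
Implicit Types (g : nat -> nat -> C) (k : seq nat).

(** Recursion on the first index follows the recursion of the stuffle
    product. *)
Fixpoint nsum g M k m : C :=
  if k is a :: k' then \sum_(m <= n < M) g a n * nsum g M k' n.+1 else 1.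

Lemma eq_nsum g h M k m :
    (forall a n, a \in k -> (m <= n < M)%N -> g a n = h a n) ->
  nsum g M k m = nsum h M k m.
Proof.
elim: k m => //= a k IHk m gh; apply: eq_big_nat => n /andP[mn nM].
rewrite gh ?mem_head ?mn// (IHk n.+1)// => b p bk /andP[np pM].
by apply: gh; rewrite ?inE ?bk ?orbT// pM (leq_trans mn (ltnW np)).
Qed.

Lemma nsumZ (c : C) g M k m :
  nsum (fun a n => c ^+ a * g a n) M k m = c ^+ weight k * nsum g M k m.
Proof.
elim: k m => [|a k IHk] m /=; first by rewrite mul1r.
by rewrite mulr_sumr; apply: eq_bigr => n _; rewrite IHk exprD; ring.
Qed.

Lemma nsum_shift d g M k m :
  nsum g (M + d) k (m + d) = nsum (fun a n => g a (n + d)%N) M k m.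
Proof.
elim: k m => //= a k IHk m; rewrite big_addn addnK.
by apply: eq_bigr => n _; rewrite -IHk.
Qed.

Lemma nsum_ltn g M a k m : (m < M)%N ->
  nsum g M (a :: k) m = g a m * nsum g M k m.+1 + nsum g M (a :: k) m.+1.
Proof. by move=> mM; rewrite /= big_ltn. Qed.

(** Summing over the last index outermost is what tail estimates need: the
    increment of the sum from M to M + 1 is then a single term. *)
Lemma nsum_rcons g M k a m :
  nsum g M (rcons k a) m = \sum_(m <= n < M) g a n * nsum g n k m.
Proof.
elim: k m => [//|b k IHk] m /=.
under eq_bigr do rewrite IHk.
have -> : \sum_(m <= p < M) g b p * \sum_(p.+1 <= n < M) g a n * nsum g n k p.+1
   = \sum_(m <= p < M) \sum_(m <= n < M | (p < n)%N)
        g b p * (g a n * nsum g n k p.+1).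
  apply: eq_big_nat => p /andP[mp _].
  by rewrite mulr_sumr (big_nat_widenl p.+1 m) 1?leqW.
rewrite (exchange_big_dep_nat xpredT)//=.
apply: eq_big_nat => n /andP[mn nM].
rewrite mulr_sumr (big_nat_widen m n M) 1?ltnW//=.
by apply: eq_big => // p _; ring.
Qed.

(** In an increasing chain the indices below c form an initial segment. *)
Lemma nsum_cut c g M k m : (m <= c <= M)%N ->
  nsum g M k m =
    \sum_(j < (size k).+1) nsum g c (take j k) m * nsum g M (drop j k) c.
Proof.
elim: k m => [|a k IHk] m /andP[mc cM] /=; first by rewrite big_ord1 mulr1.
rewrite big_ord_recl/= mul1r addrC (big_cat_nat mc cM)/=; congr (_ + _).
under [RHS]eq_bigr do rewrite mulr_suml.
rewrite exchange_big/=; apply: eq_big_nat => n /andP[mn nc].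
rewrite IHk ?nc// mulr_sumr; apply: eq_bigr => j _.
by rewrite mulrA.
Qed.

Lemma nsum_rev g c k m : (m <= c)%N ->
  nsum g c k m = nsum (fun a n => g a (c - n.+1)%N) (c - m) (rev k) 0.
Proof.
elim: k m => [//|a k IHk] m mc.
rewrite rev_cons nsum_rcons /= big_nat_rev/= -{1}[m]add0n big_addn.
apply: eq_big_nat => n /andP[_ ncm].
have -> : (m + c - (n + m).+1 = c - n.+1)%N by lia.
rewrite IHk; last by lia.
by have -> : (c - (c - n.+1).+1 = n)%N by lia.
Qed.

End NestedSums.

Section TupleSum.
Context (R : realType).

(** Induction on the length does not go through for sorted tuples alone: the
    lower bound m on the entries is what the head of the tuple imposes on its
    tail. *)
Lemma nested_sumE lo M k (s : R[i]) :
  nested_sum lo M k s =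
  nsum (fun a n => (((lo + n%:Z)%:~R + s) ^+ a)^-1) M k 0.
Proof.
set g := fun a n => _.
pose ns m r (k : seq nat) := \sum_(t : r.-tuple 'I_M |
    path leq m (map val t) && sorted ltn (map val t))
    \prod_(i < r) g (nth 0%N k i) (tnth t i).
have nsE m r (k' : seq nat) : size k' = r -> ns m r k' = nsum g M k' m.
  elim: k' r m => [|a k' IHk] r m <- {r}.
    rewrite /ns (big_pred1 [tuple]) ?big_ord0//.
    by move=> t; rewrite [t]tuple0 /= eqxx.
  rewrite /ns /=.
  rewrite (reindex (fun p : 'I_M * (size k').-tuple 'I_M =>
      [tuple of p.1 :: p.2])); last first.
    exists (fun t => (thead t, [tuple of behead t])) => [[x t] _|t _] /=.
      by rewrite theadE; congr (_, _); apply: val_inj.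
    by rewrite -tuple_eta.
  rewrite -(pair_big_dep xpredT (fun (x : 'I_M) (t : (size k').-tuple 'I_M) =>
     path leq m (map val [tuple of x :: t]) &&
     sorted ltn (map val [tuple of x :: t]))
    (fun x t => \prod_(i < (size k').+1)
       g (nth 0%N (a :: k') i) (tnth [tuple of x :: t] i)))/=.
  rewrite [RHS]big_geq_mkord/=.
  rewrite [RHS]big_mkcond.
  apply: eq_bigr => x _; case: ifPn => mx; last first.
    exact: big1.
  rewrite -(IHk _ x.+1 erefl) mulr_sumr; apply: eq_big.
    move=> t; rewrite /=.
    case: (map _ t) => [|y l] /=; first by [].
    by case: ltnP => [xy|]; rewrite ?andbF //= (ltnW xy)  ?andbT/=.
  move=> t _; rewrite big_ord_recl/= ; congr (_ * _).
  by apply: eq_bigr => i _; rewrite tnthS.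
rewrite -(nsE _ _ k erefl); apply: eq_bigl => t.
case: (map _ t) => //= x l; case: (path ltn x l) /idP => // xl.
  by rewrite (sub_path (@ltnW) xl).
by rewrite andbF.
Qed.

End TupleSum.

(** * The stuffle algebra *)

Section WordSpan.
Implicit Types (k l w : seq nat) (D E F : word_span) (c : rat).

Lemma add3ACA (V : zmodType) (a b c a' b' c' : V) :
  (a + a') + (b + b') + (c + c') = (a + b + c) + (a' + b' + c').
Proof. exact: (AC ((2*2)*2) ((1*3*5)*(2*4*6))). Qed.

Lemma freegUZ c w : << c *g w >> = c *: << w >> :> word_span.
Proof. by apply/eqP/freeg_eqP => v; rewrite coeffZ !coeffU mul1r. Qed.

(** Identities that are linear in D reduce to words through this principle. *)
Lemma word_span_ind (P : word_span -> Prop) :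
  P 0 -> (forall c w D, P D -> P (c *: << w >> + D)) -> forall D, P D.
Proof.
move=> P0 PD; elim/freeg_ind_dom0 => // c w D _ _ PDD.
by rewrite freegUZ; apply: PD.
Qed.

Lemma fglift_is_linear (M : lmodType rat) (f : seq nat -> M) :
  linear (fglift f : word_span -> M).
Proof.
have fB := lift_is_additive f.
have f0 : fglift f (0 : word_span) = 0 by rewrite -(subrr 0) fB subrr.
have fD D E : fglift f (D + E) = fglift f D + fglift f E.
  by rewrite -[E]opprK fB -(sub0r (- E)) fB f0 sub0r.
move=> c D E; rewrite fD; congr (_ + _).
elim/word_span_ind: D => [|d w D IH]; first by rewrite scaler0 f0 scaler0.
rewrite scalerDr !fD IH scalerDr; congr (_ + _).
by rewrite scalerA -!freegUZ !liftU scalerA.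
Qed.

HB.instance Definition _ (M : lmodType rat) (f : seq nat -> M) :=
  GRing.isLinear.Build rat word_span M _ (fglift f : word_span -> M)
    (fglift_is_linear f).

HB.instance Definition _ a :=
  GRing.Linear.copy (prefix_word a)
    (fglift (fun w : seq nat => << a :: w >> : word_span)).

Lemma prefix_wordU a w : prefix_word a << w >> = << a :: w >>.
Proof. by rewrite /prefix_word liftU scale1r. Qed.

Lemma stuffleUl k E : stuffle << k >> E = fglift (stuffle_word k) E.
Proof. by rewrite /stuffle liftU scale1r. Qed.

Lemma stuffleU k l : stuffle << k >> << l >> = stuffle_word k l.
Proof. by rewrite stuffleUl liftU scale1r. Qed.

Lemma stuffle0l E : stuffle 0 E = 0.
Proof. exact: linear0. Qed.

Lemma stuffleDl D D' E : stuffle (D + D') E = stuffle D E + stuffle D' E.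
Proof. exact: linearD. Qed.

Lemma stuffleZl c D E : stuffle (c *: D) E = c *: stuffle D E.
Proof. exact: linearZ. Qed.

Lemma stuffle_is_linear D : linear (stuffle D).
Proof.
elim/word_span_ind: D => [|d w D IH] c E F.
  by rewrite !stuffle0l scaler0 addr0.
rewrite !stuffleDl !stuffleZl !stuffleUl IH linearP/= !scalerDr !scalerA.
by rewrite [d * c]mulrC; apply: (AC (2*2) ((1*3)*(2*4))).
Qed.

HB.instance Definition _ D :=
  GRing.isLinear.Build rat word_span word_span _ (stuffle D)
    (stuffle_is_linear D).

Lemma stuffle_wordC k l : stuffle_word k l = stuffle_word l k.
Proof.
elim: k l => [|a k IHk]; first by case.
elim=> [//|b l IHl] /=.
rewrite -/(stuffle_word (a :: k) l) IHk IHl IHk addnC.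
by rewrite [X in X + _]addrC.
Qed.

Lemma stuffleC D E : stuffle D E = stuffle E D.
Proof.
elim/word_span_ind: D E => [|c k D IH] E; first by rewrite stuffle0l linear0.
rewrite stuffleDl linearD/= IH stuffleZl linearZ/=; congr (_ *: _ + _).
elim/word_span_ind: {IH} E => [|d l E IHE]; first by rewrite stuffle0l linear0.
rewrite stuffleDl linearD/= IHE stuffleZl linearZ/=; congr (_ *: _ + _).
by rewrite !stuffleU stuffle_wordC.
Qed.

Lemma stuffle1l E : stuffle << [::] >> E = E.
Proof.
elim/word_span_ind: E => [|d l E IHE]; first exact: linear0.
by rewrite linearP/= IHE stuffleU.
Qed.

Lemma stuffle1r D : stuffle D << [::] >> = D.
Proof. by rewrite stuffleC stuffle1l. Qed.

(** The recursion of the stuffle product on words, extended bilinearly; in this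
    form it applies to the products that arise inside a triple product. *)
Lemma stuffle_prefix a b D E :
  stuffle (prefix_word a D) (prefix_word b E) =
    prefix_word a (stuffle D (prefix_word b E))
    + prefix_word b (stuffle (prefix_word a D) E)
    + prefix_word (a + b)%N (stuffle D E).
Proof.
elim/word_span_ind: D E => [|c k D IH] E.
  by rewrite !linear0 !stuffle0l !linear0 !addr0.
rewrite linearP/= !stuffleDl !stuffleZl IH !linearP/=.
rewrite add3ACA -!scalerDr.
congr (_ *: _ + _); rewrite prefix_wordU.
elim/word_span_ind: {IH} E => [|d l E IHE]; first by rewrite !linear0 !addr0.
rewrite !linearP/= IHE !prefix_wordU !stuffleU.
rewrite add3ACA -!scalerDr.
by congr (_ *: _ + _); rewrite ?prefix_wordU.
Qed.

(** Both bracketings expand into the seven kinds of words that begin with a, b,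
    c, a+b, a+c, b+c or a+b+c.  After a, and after c, the tail is a triple
    product only once three terms have been collected, which is the purpose of
    PA and PC below. *)
Lemma stuffle_wordA k l w :
  stuffle << k >> (stuffle << l >> << w >>) =
  stuffle (stuffle << k >> << l >>) << w >>.
Proof.
have [n] := ubnP (size k + size l + size w).
elim: n k l w => // n IH [|a k] l w.
  by rewrite !stuffle1l.
case: l => [|b l]; first by rewrite stuffle1l stuffle1r.
case: w => [|c w] /=; first by rewrite !stuffle1r.
move=> Hn; rewrite -!prefix_wordU.
have E1 := IH k (b :: l) (c :: w) ltac:(rewrite /=; lia).
have E2 := IH (a :: k) l (c :: w) ltac:(rewrite /=; lia).
have E3 := IH (a :: k) (b :: l) w ltac:(rewrite /=; lia).
have E4 := IH k l (c :: w) ltac:(rewrite /=; lia).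
have E5 := IH (a :: k) l w ltac:(rewrite /=; lia).
have E6 := IH k (b :: l) w ltac:(rewrite /=; lia).
have E7 := IH k l w ltac:(rewrite /=; lia).
rewrite -!prefix_wordU in E1 E2 E3 E4 E5 E6.
have PA := congr1 (prefix_word a) E1.
have PC := congr1 (prefix_word c) E3.
rewrite stuffle_prefix !linearD/= in PA.
rewrite [stuffle (prefix_word a _) (prefix_word b _)]stuffle_prefix in PC.
rewrite !stuffleDl !linearD/= in PC.
rewrite !stuffle_prefix !linearD/= !stuffleDl !stuffle_prefix.
rewrite -PA PC E2 E4 E5 E6 E7 addnA.
exact: (AC (3*(1*3*1)*3) (((1*4*9)*5*8)*(2*6*10)*(3*7*11))).
Qed.

Lemma stuffleA : associative stuffle.
Proof.
move=> D E F.
elim/word_span_ind: D => [|c k D IH]; first by rewrite !stuffle0l.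
rewrite !stuffleDl !stuffleZl IH; congr (_ *: _ + _).
elim/word_span_ind: {IH} E => [|d l E IHE].
  by rewrite !(stuffle0l, linear0).
rewrite linearP !stuffleDl !stuffleZl linearP/= IHE; congr (_ *: _ + _).
elim/word_span_ind: {IHE} F => [|e w F IHF]; first by rewrite !linear0.
by rewrite !linearP/= IHF stuffle_wordA.
Qed.

End WordSpan.

(** * Existence of the decomposition into admissible parts *)

Section Decomposition.
Implicit Types (k a w : seq nat) (D E : word_span) (c : rat).

(** The decomposition property for an arbitrary element and a depth bound r
    that is not tied to a word, so that it is preserved by linear
    combinations. *)
Definition stuffle_decomposable r D := exists2 u : nat -> word_span,
  forall (l : nat) w, (l <= r)%N -> w \in dom (u l) ->
    admissible w /\ (size w <= r - l)%N &
  D = \sum_(l < r.+1) stuffle (u l) (stuffle_pow << [:: 1%N] >> l).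

Local Notation one_pow := (stuffle_pow << [:: 1%N] >>).

Lemma decomposable_lin r c D E : stuffle_decomposable r D ->
  stuffle_decomposable r E -> stuffle_decomposable r (c *: D + E).
Proof.
move=> [u uP ->] [v vP ->]; exists (fun l => c *: u l + v l).
  move=> l w lr /domD_subset; rewrite mem_cat => /orP[/domZ_subset|].
    exact: uP.
  exact: vP.
rewrite scaler_sumr -big_split/=; apply: eq_bigr => l _.
by rewrite stuffleDl stuffleZl.
Qed.

Lemma decomposable_admissible r w : admissible w -> (size w <= r)%N ->
  stuffle_decomposable r << w >>.
Proof.
move=> aw wr; exists (fun l => if l == 0%N then << w >> else 0).
  by case=> [|l] v _ /=; rewrite ?dom0// domU1 inE => /eqP->; rewrite subn0.
rewrite big_ord_recl/= stuffle1r big1 ?addr0// => i _.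
exact: stuffle0l.
Qed.

Lemma decomposable0 r : stuffle_decomposable r 0.
Proof.
exists (fun=> 0); first by move=> l w _; rewrite dom0.
by rewrite big1// => l _; exact: stuffle0l.
Qed.

Lemma decomposable_leq r r' D : (r <= r')%N ->
  stuffle_decomposable r D -> stuffle_decomposable r' D.
Proof.
move=> rr' [u uP ->]; exists (fun l => if (l <= r)%N then u l else 0).
  move=> l w lr'; case: ifP => [lr|_]; last by rewrite dom0.
  by move=> /(uP _ _ lr)[-> wr]; split=> //; lia.
rewrite (big_ord_widen r'.+1 (fun l => stuffle (u l) (one_pow l)))//.
rewrite big_mkcond/=; apply: eq_bigr => l _; rewrite ltnS.
by case: ifP => _; rewrite ?stuffle0l.
Qed.

(** Multiplication by (1) shifts the exponents of (1) by one; this is where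
    associativity is needed. *)
Lemma decomposable_mul1 r D : stuffle_decomposable r D ->
  stuffle_decomposable r.+1 (stuffle D << [:: 1%N] >>).
Proof.
move=> [u uP ->]; exists (fun l => if l is l'.+1 then u l' else 0).
  by case=> [|l] w lr; [rewrite dom0|exact: uP].
rewrite [RHS]big_ord_recl/= stuffle0l add0r stuffleC linear_sum/=.
by apply: eq_bigr => l _; rewrite stuffleA [stuffle _ (u l)]stuffleC -stuffleA.
Qed.

(** The part a is required to be nonempty: then prefixing a letter never
    creates a new trailing one, even when that letter is 1. *)
Definition trailing_ones_le t r w := exists a j,
  [/\ w = a ++ nseq j 1%N, is_index a, (1 < last 0 a)%N, (j <= t)%N
    & (size w <= r)%N].

Definition spanned_by (P : seq nat -> Prop) D := forall w, w \in dom D -> P w.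

Lemma spanned_by_lin P c D E :
  spanned_by P D -> spanned_by P E -> spanned_by P (c *: D + E).
Proof.
move=> PD PE w /domD_subset; rewrite mem_cat => /orP[/domZ_subset|].
  exact: PD.
exact: PE.
Qed.

Lemma spanned_byD P D E :
  spanned_by P D -> spanned_by P E -> spanned_by P (D + E).
Proof. by move=> PD PE; rewrite -[D]scale1r; apply: spanned_by_lin. Qed.

Lemma spanned_byU (P : seq nat -> Prop) w : P w -> spanned_by P << w >>.
Proof. by move=> Pw v; rewrite domU1 inE => /eqP->. Qed.

Lemma spanned_by_fglift (P Q : seq nat -> Prop) (f : seq nat -> word_span) D :
    spanned_by P D -> (forall w, P w -> spanned_by Q (f w)) ->
  spanned_by Q (fglift f D).
Proof.
move=> PD PQ; rewrite -(freeg_sumE D) linear_sum/=.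
rewrite big_seq; elim/big_ind: _ => [w|E F|w wD]; first by rewrite dom0.
  exact: spanned_byD.
rewrite freegUZ linearZ/= liftU scale1r -[_ *: _]addr0.
by apply: spanned_by_lin; [apply/PQ/PD|move=> v; rewrite dom0].
Qed.

(** Inserting a 1 next to one of the t trailing ones gives (a, 1^(t+1)), in t+1
    ways; inserting it inside a, or adding it to an entry, leaves at most t
    trailing ones. *)
Lemma stuffle_word1 t a :
    is_index a -> (a == [::]) || (1 < last 0 a)%N ->
  exists2 D : word_span, spanned_by (trailing_ones_le t (size a + t).+1) D &
    stuffle_word (a ++ nseq t 1%N) [:: 1%N] =
      t.+1%:R *: << a ++ nseq t.+1 1%N >> + D.
Proof.
elim: a => [_ _ /=|x a IHa /= /andP[x0 ia] xa].
  elim: t => [|t [D PD IHt]].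
    by exists 0 => [w|]; [rewrite dom0|rewrite scale1r addr0].
  exists (prefix_word 1 D + << 2%N :: nseq t 1%N >>).
    apply: spanned_byD.
      apply: (spanned_by_fglift PD) => w [a [j [-> ia la jt wt]]].
      apply: spanned_byU; exists (1%N :: a), j.
      by split=> //; [case: (a) la|lia].
    apply: spanned_byU; exists [:: 2%N], t; split => //=.
    by rewrite size_nseq; lia.
  rewrite /= IHt linearD linearZ/= prefix_wordU.
  rewrite [t.+2%:R]mulrS scalerDl scale1r.
  rewrite (_ : stuffle_word _ [::] = << nseq t 1%N >>); last by case: (t).
  rewrite prefix_wordU; exact: (AC 4 ((3*1)*(2*4))).
have [|D PD E] := IHa ia.
  by case: (a) xa.
set w := a ++ nseq t 1%N in E *.
have sw : size w = (size a + t)%N by rewrite size_cat size_nseq.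
exists (prefix_word x D + (<< 1%N :: x :: w >> + << (x + 1)%N :: w >>)).
  apply: spanned_byD.
    apply: (spanned_by_fglift PD) => v [b [j [-> ib lb jt vr]]].
    apply: spanned_byU; exists (x :: b), j; split=> //=; last by case: (b) lb.
    exact/andP.
  apply: spanned_byD; apply: spanned_byU.
    by exists (1%N :: x :: a), t; split=> //=; rewrite ?sw//; exact/andP.
  exists ((x + 1)%N :: a), t; split=> //=; last by rewrite sw.
    by rewrite -/(is_index a) ia addn1.
  by case: (a) xa => //=; lia.
rewrite E linearD linearZ/= !prefix_wordU.
rewrite (_ : stuffle_word w [::] = << w >>); last by case: (w).
by rewrite prefix_wordU -!addrA.
Qed.

(** Solving the identity of stuffle_word1 for (a, 1^(t+1)) expresses it by
    (a, 1^t) * (1) and by words with at most t trailing ones. *)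
Lemma decomposable_index r a t : is_index a ->
    (a == [::]) || (1 < last 0 a)%N -> (size a + t <= r)%N ->
  stuffle_decomposable r << a ++ nseq t 1%N >>.
Proof.
have [n] := ubnP t; elim: n t r a => // n IHn [|t] r a tn ia la ar.
  rewrite cats0; apply: decomposable_admissible; last by lia.
  by rewrite /admissible ia.
have [D PD E] := stuffle_word1 t ia la.
have -> : << a ++ nseq t.+1 1%N >> =
    t.+1%:R^-1 *: stuffle << a ++ nseq t 1%N >> << [:: 1%N] >>
    + (- t.+1%:R^-1) *: D :> word_span.
  rewrite stuffleU E scalerDr scalerA mulVf ?pnatr_eq0// scale1r scaleNr.
  by rewrite addrK.
apply: decomposable_lin.
  apply: (@decomposable_leq (size a + t).+1); first by lia.
  by apply: decomposable_mul1; apply: IHn => //; lia.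
rewrite -[_ *: D]addr0; apply: decomposable_lin; last exact: decomposable0.
rewrite -(freeg_sumE D) big_seq.
elim/big_ind: _ => [|x y Dx Dy|w /PD[b [j [-> ib lb jt wr]]]].
- exact: decomposable0.
- by rewrite -[x]scale1r; apply: decomposable_lin.
rewrite freegUZ -[_ *: _]addr0.
apply: decomposable_lin; last exact: decomposable0.
apply: IHn => //; rewrite ?lb ?orbT//; first by lia.
by move: wr; rewrite size_cat size_nseq; lia.
Qed.

Lemma index_trailing_ones k : is_index k -> exists a t,
  [/\ k = a ++ nseq t 1%N, is_index a & (a == [::]) || (1 < last 0 a)%N].
Proof.
elim/last_ind: k => [_|k x IHk]; first by exists [::], 0%N.
rewrite /is_index all_rcons => /andP[x0 ik].
have [x1|x1] := leqP x 1.
  have [a [t [-> ia la]]] := IHk ik; exists a, t.+1; split=> //.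
  by rewrite -cats1 -catA -(addn1 t) nseqD (_ : x = 1%N)//; lia.
exists (rcons k x), 0%N.
by rewrite cats0 last_rcons x1 orbT /is_index all_rcons x0.
Qed.

Lemma stuffle_decompP k : is_index k -> is_stuffle_decomp (stuffle_decomp k).
Proof.
move=> /index_trailing_ones[a [t [ek ia la]]].
have [|u uP E] := @decomposable_index (size k) a t ia la.
  by rewrite ek size_cat size_nseq.
rewrite -ek in E.
apply: xgetPex; exists [ffun l : 'I__ => u l]; split => [l w|].
  by rewrite ffunE; apply: uP; rewrite -ltnS.
by rewrite {1}E; apply: eq_bigr => l _; rewrite ffunE.
Qed.

End Decomposition.

(** * Nested sums as stuffle homomorphisms *)

Section Evaluation.
Context (C : numFieldType).
Implicit Types (F : seq nat -> C) (k w : seq nat) (D E : word_span) (c : rat).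

Definition word_eval F D : C := \sum_(w <- dom D) ratr (coeff w D) * F w.

Lemma word_eval_sup F D (r : seq (seq nat)) : uniq r -> {subset dom D <= r} ->
  word_eval F D = \sum_(w <- r) ratr (coeff w D) * F w.
Proof.
move=> ur Dr; rewrite /word_eval [RHS](bigID (mem (dom D)))/=.
rewrite [X in _ + X]big1 ?addr0; last first.
  by move=> w /coeff_outdom->; rewrite rmorph0 mul0r.
rewrite -[RHS]big_filter; apply: perm_big; apply: uniq_perm.
- exact: uniq_dom.
- exact: filter_uniq.
- by move=> w; rewrite mem_filter /=; case: (boolP (w \in dom D)) => // /Dr->.
Qed.

Lemma word_eval_lin F c D E :
  word_eval F (c *: D + E) = ratr c * word_eval F D + word_eval F E.
Proof.
set r := undup (dom D ++ dom E ++ dom (c *: D + E)).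
have ur : uniq r by exact: undup_uniq.
rewrite !(@word_eval_sup F _ r)//; try by move=> w wD;
  rewrite mem_undup !mem_cat wD ?orbT.
rewrite mulr_sumr -big_split/=; apply: eq_bigr => w _.
by rewrite coeffD coeffZ rmorphD rmorphM mulrDl mulrA.
Qed.

Lemma word_eval0 F : word_eval F 0 = 0.
Proof. by rewrite /word_eval dom0 big_nil. Qed.

Lemma word_evalD F D E : word_eval F (D + E) = word_eval F D + word_eval F E.
Proof. by rewrite -[D]scale1r word_eval_lin rmorph1 mul1r scale1r. Qed.

Lemma word_evalU F w : word_eval F << w >> = F w.
Proof.
by rewrite /word_eval domU1 big_seq1 coeffU eqxx mulr1 rmorph1 mul1r.
Qed.

Lemma word_eval_stuffle F D E :
    (forall k l, word_eval F (stuffle_word k l) = F k * F l) ->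
  word_eval F (stuffle D E) = word_eval F D * word_eval F E.
Proof.
move=> FM; elim/word_span_ind: D => [|c k D IH].
  by rewrite stuffle0l word_eval0 mul0r.
rewrite stuffleDl stuffleZl !word_eval_lin mulrDl IH; congr (_ + _).
rewrite word_evalU -[RHS]mulrA; congr (_ * _).
elim/word_span_ind: {IH} E => [|d l E IHE].
  by rewrite linear0 word_eval0 mulr0.
rewrite linearP/= !word_eval_lin IHE stuffleU FM word_evalU.
by rewrite mulrDr mulrCA.
Qed.

Lemma word_eval_pow F l :
    (forall k l, word_eval F (stuffle_word k l) = F k * F l) -> F [::] = 1 ->
  word_eval F (stuffle_pow << [:: 1%N] >> l) = F [:: 1%N] ^+ l.
Proof.
move=> FM F1; elim: l => [|l IHl]; rewrite /stuffle_pow /=.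
  by rewrite word_evalU F1.
by rewrite word_eval_stuffle// -/(stuffle_pow _ _) IHl word_evalU exprS.
Qed.

(** The pairs of indices are split into n < p, p < n and n = p: this is the
    source of the three terms of the stuffle product. *)
Lemma mul_big_nat (A B : nat -> C) m M :
  (\sum_(m <= n < M) A n) * (\sum_(m <= n < M) B n) =
    \sum_(m <= n < M) A n * (\sum_(n.+1 <= p < M) B p)
    + \sum_(m <= n < M) B n * (\sum_(n.+1 <= p < M) A p)
    + \sum_(m <= n < M) A n * B n.
Proof.
have [d] := ubnP (M - m); elim: d m => // d IHd m dm.
have [Mm|mM] := leqP M m; first by rewrite !big_geq// mul0r !addr0.
rewrite !(@big_ltn _ _ _ m M)// mulrDl !mulrDr IHd; last by lia.
ring.
Qed.

Lemma word_eval_prefix g M m a D :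
  word_eval (nsum g M ^~ m) (prefix_word a D) =
    \sum_(m <= n < M) g a n * word_eval (nsum g M ^~ n.+1) D.
Proof.
elim/word_span_ind: D => [|c w D IH].
  rewrite linear0 word_eval0 big1// => n _.
  by rewrite word_eval0 mulr0.
rewrite linearP/= word_eval_lin IH prefix_wordU word_evalU /= mulr_sumr.
rewrite -big_split/=; apply: eq_bigr => n _.
by rewrite word_eval_lin word_evalU; ring.
Qed.

Lemma nsum_stuffle (g : nat -> nat -> C) M m k l :
    (forall a b n, g (a + b)%N n = g a n * g b n) ->
  word_eval (nsum g M ^~ m) (stuffle_word k l) = nsum g M k m * nsum g M l m.
Proof.
move=> gD; elim: k l m => [|a k IHk] l m; first by rewrite word_evalU mul1r.
elim: l m => [|b l IHl] m; first by rewrite word_evalU mulr1.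
rewrite /= !word_evalD !word_eval_prefix mul_big_nat; congr (_ + _ + _).
- by apply: eq_bigr => n _; rewrite IHk mulrA.
- by apply: eq_bigr => n _; rewrite -/(stuffle_word (a :: k) l) IHl /=; ring.
- by apply: eq_bigr => n _; rewrite gD IHk; ring.
Qed.

End Evaluation.

(** * Logarithmic weights *)

Section LogBounds.
Context (R : realType).
Implicit Types (d n N : nat).

(** The value at 0 is also 1, since ln 0 = 0, so that logp is monotone and at
    least 1 on all of nat. *)
Definition logp n : R := 1 + ln n%:R.

Lemma logp_ge1 n : 1 <= logp n.
Proof.
rewrite lerDl; case: n => [|n]; first by rewrite ln0.
by apply: ln_ge0; rewrite ler1n.
Qed.

Lemma logp_gt0 n : 0 < logp n.
Proof. exact: lt_le_trans ltr01 (logp_ge1 n). Qed.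

Lemma logp_le m n : (m <= n)%N -> logp m <= logp n.
Proof.
case: m => [|m] mn; first by rewrite {1}/logp ln0// addr0 logp_ge1.
by rewrite lerD2l ler_ln ?posrE ?ltr0n ?ler_nat// (leq_trans _ mn).
Qed.

Lemma logp_succ n : (0 < n)%N -> logp n.+1 <= logp n + n%:R^-1.
Proof.
move=> n0; have n0' : (0 : R) < n%:R by rewrite ltr0n.
rewrite /logp -addrA lerD2l.
have -> : n.+1%:R = n%:R * (1 + n%:R^-1) :> R.
  by rewrite mulrDr mulr1 divff ?gt_eqF// natr1.
have i0 : (0 : R) < n%:R^-1 by rewrite invr_gt0.
rewrite lnM ?posrE ?addr_gt0//.
by rewrite lerD2l le_ln1Dx// (lt_trans _ i0)// ltrN10.
Qed.

Lemma logp_succ2 n : (0 < n)%N -> logp n.+1 <= 2 * logp n.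
Proof.
move=> n0; apply: le_trans (logp_succ n0) _.
rewrite mulr2n mulrDl !mul1r lerD2l (le_trans _ (logp_ge1 n))//.
by rewrite invf_le1 ?ler1n// ltr0n.
Qed.

Lemma harmonic_le_logp N : \sum_(1 <= n < N) n%:R^-1 <= logp N.
Proof.
suff H n : \sum_(1 <= i < n.+2) i%:R^-1 <= logp n.+1.
  case: N => [|[|N]]; try by rewrite big_geq// ltW// logp_gt0.
  by apply: le_trans (H N) _; exact: logp_le.
elim: n => [|n IHn]; first by rewrite big_nat1 invr1 logp_ge1.
rewrite big_nat_recr//=; apply: le_trans (lerD IHn (lexx _)) _.
have n1 : (0 : R) < n.+1%:R by [].
have n2 : (0 : R) < n.+2%:R by [].
have E : n.+1%:R = n.+2%:R * (1 + - n.+2%:R^-1) :> R.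
  by rewrite mulrDr mulr1 mulrN divff ?gt_eqF// -[n.+2%:R]natr1 addrK.
have i2 : n.+2%:R^-1 < (1 : R) by rewrite invf_lt1// ltr1n.
rewrite {1}/logp E lnM ?posrE// ?subr_gt0// -/(logp n.+2) /logp -!addrA lerD2l.
by rewrite gerDl -lerBrDr sub0r le_ln1Dx// ltrN2.
Qed.

Lemma subrXn_le (x y : R) d : 0 <= y -> y <= x ->
  x ^+ d.+1 - y ^+ d.+1 <= d.+1%:R * x ^+ d * (x - y).
Proof.
move=> y0 yx; rewrite subrXX mulrC ler_wpM2r ?subr_ge0//.
rewrite -[d.+1 in leRHS]card_ord mulr_natl -sumr_const ler_sum// => i _.
have x0 := le_trans y0 yx.
have -> : x ^+ d = x ^+ (d.+1.-1 - i) * x ^+ i.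
  by rewrite -exprD subnK// -ltnS.
rewrite ler_wpM2l ?exprn_ge0// ?lerXn2r ?nnegrE//.
Qed.

(** A discrete primitive of L_n^d / n^2 of the size L_n^d / n.  Up to a constant
    it is L_n^d / n itself: its decrement exceeds L_n^d / (n (n+1)) except for
    an error of one power of the logarithm less, which the primitive for d - 1
    compensates. *)
Lemma log_tail d : exists psi : nat -> R, exists2 A : R, 0 <= A &
  forall n, (0 < n)%N ->
    [/\ 0 <= psi n, psi n <= A * (logp n ^+ d / n%:R) &
      logp n ^+ d / (n%:R * n.+1%:R) <= psi n - psi n.+1].
Proof.
elim: d => [|d [psi [A A0 H]]].
  exists (fun n => n%:R^-1), 1 => // n n0; split.
  - by rewrite invr_ge0.
  - by rewrite expr0 !mul1r.
  - have n0' : (n%:R : R) != 0 by rewrite pnatr_eq0 -lt0n.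
    rewrite expr0 le_eqVlt; apply/orP; left; apply/eqP.
    by rewrite -natr1; field; rewrite n0' natr1 pnatr_eq0.
pose c : R := d.+1%:R * 2 ^+ d.
have c0 : 0 <= c by rewrite mulr_ge0// exprn_ge0.
exists (fun n => logp n ^+ d.+1 / n%:R + c * psi n), (1 + c * A).
  by rewrite addr_ge0// mulr_ge0.
move=> n n0; have [p0 pA pd] := H n n0.
have n0' : (0 : R) < n%:R by rewrite ltr0n.
have l1 := logp_ge1 n; have l0 := ltW (logp_gt0 n).
split.
- by rewrite addr_ge0 ?mulr_ge0 ?exprn_ge0 ?invr_ge0// ltW.
- rewrite mulrDl mul1r lerD2l -mulrA ler_wpM2l// (le_trans pA)// ler_wpM2l//.
  by apply: ler_wpM2r; [rewrite invr_ge0 ltW|exact: ler_weXn2l].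
- have n1' : (0 : R) < n.+1%:R by [].
  have inc : logp n.+1 ^+ d.+1 <= logp n ^+ d.+1 + c * logp n ^+ d / n%:R.
    rewrite -lerBlDl; apply: le_trans (subrXn_le _ l0 (logp_le (leqnSn n))) _.
    rewrite /c -!mulrA ler_wpM2l// [leRHS]mulrA -exprMn.
    apply: ler_pM.
    + by rewrite exprn_ge0// ltW// logp_gt0.
    + by rewrite subr_ge0 logp_le.
    + rewrite lerXn2r ?nnegrE ?logp_succ2// ?mulr_ge0//.
      by rewrite ltW// logp_gt0.
    + by rewrite lerBlDl logp_succ.
  have : logp n.+1 ^+ d.+1 / n.+1%:R <=
      (logp n ^+ d.+1 + c * logp n ^+ d / n%:R) / n.+1%:R.
    by apply: ler_wpM2r inc; rewrite invr_ge0 ltW.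
  have := ler_wpM2l c0 pd.
  rewrite !mulrBr.
  have -> : (logp n ^+ d.+1 + c * logp n ^+ d / n%:R) / n.+1%:R =
     logp n ^+ d.+1 / n%:R - logp n ^+ d.+1 / (n%:R * n.+1%:R)
     + c * (logp n ^+ d / (n%:R * n.+1%:R)).
    have e1 : n.+1%:R = n%:R + 1 :> R by rewrite natr1.
    rewrite e1; field; rewrite -e1.
    by rewrite !gt_eqF.
  set x1 := _ / n.+1%:R; set x2 := logp n ^+ d.+1 / n%:R.
  set x3 := logp n ^+ d.+1 / (_ * _); set x4 := c * (_ / _).
  set x5 := c * psi n; set x6 := c * psi n.+1.
  lra.
Qed.

End LogBounds.

(** * Limits of complex sequences with majorized increments *)

Section ComplexConvergence.
Context (R : realType).
Implicit Types (z : R[i]).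

Local Notation nrm := (@ComplexField.Normc.normc R).

Lemma norm_normc z : `|z| = (nrm z)%:C.
Proof. by []. Qed.

Lemma normcD_le z z' : nrm (z + z') <= nrm z + nrm z'.
Proof. exact: le_normcD. Qed.

Lemma normc_ge0 z : 0 <= nrm z.
Proof. by case: z => a b; exact: sqrtr_ge0. Qed.

Lemma normcXn z n : nrm (z ^+ n) = nrm z ^+ n.
Proof.
elim: n => [|n IHn]; first by rewrite !expr0 ComplexField.Normc.normc1.
by rewrite !exprS ComplexField.Normc.normcM IHn.
Qed.

Lemma normc_real (x : R) : nrm x%:C = `|x|.
Proof. by rewrite /= expr0n /= addr0 sqrtr_sqr. Qed.

Lemma normc_ReIm z : nrm z <= `|complex.Re z| + `|complex.Im z|.
Proof.
case: z => a b /=; rewrite -[leRHS]ger0_norm ?addr_ge0//.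
rewrite -sqrtr_sqr; apply: ler_wsqrtr; rewrite sqrrD !real_normK ?num_real//.
by rewrite lerD2r lerDl mulrn_wge0// mulr_ge0.
Qed.

Lemma normRe_le z : `|complex.Re z| <= nrm z.
Proof.
case: z => a b /=; rewrite -sqrtr_sqr; apply: ler_wsqrtr.
by rewrite lerDl sqr_ge0.
Qed.

Lemma normIm_le z : `|complex.Im z| <= nrm z.
Proof.
case: z => a b /=; rewrite -[X in X <= _]sqrtr_sqr; apply: ler_wsqrtr.
by rewrite lerDr sqr_ge0.
Qed.

Lemma ReB z z' : complex.Re (z - z') = complex.Re z - complex.Re z'.
Proof. by case: z z' => [a b] [a' b']. Qed.

Lemma ImB z z' : complex.Im (z - z') = complex.Im z - complex.Im z'.
Proof. by case: z z' => [a b] [a' b']. Qed.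

Section Majorized.
Variable psi : nat -> R.
Hypothesis psi0 : forall n, (0 < n)%N -> 0 <= psi n.

(** Adding psi makes the sequence nonincreasing. *)
Lemma majorized_cvg_real (x : nat -> R) :
    (forall n, (0 < n)%N -> `|x n.+1 - x n| <= psi n - psi n.+1) ->
  cvgn x.
Proof.
move=> xpsi.
have psiS n : psi n.+2 <= psi n.+1.
  by have := le_trans (normr_ge0 _) (xpsi n.+1 isT); rewrite subr_ge0.
have psi_noninc : {homo (fun n => psi n.+1) : n m / (n <= m)%N >-> m <= n}.
  by apply/nonincreasing_seqP => n; exact: psiS.
have psi_cvg : cvgn (fun n => psi n.+1).
  apply: nonincreasing_is_cvgn => //; exists 0 => _ [n _ <-]; exact: psi0.
(* Indices are shifted because nothing is assumed at 0. *)
pose v n := x n.+1 + psi n.+1.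
have v_noninc : {homo v : n m / (n <= m)%N >-> m <= n}.
  apply/nonincreasing_seqP => n; rewrite /v.
  by have := xpsi n.+1 isT; rewrite ler_norml => /andP[]; lra.
have x_low n : x 1%N - psi 1%N <= x n.+1 - psi n.+1.
  elim: n => // n IHn; apply: le_trans IHn _.
  by have := xpsi n.+1 isT; rewrite ler_norml => /andP[]; lra.
have v_cvg : cvgn v.
  apply: nonincreasing_is_cvgn => //; exists (x 1%N - psi 1%N) => _ [n _ <-].
  by rewrite /v; have := x_low n; have := psi0 (ltn0Sn n); lra.
apply/cvg_ex; exists (limn v - limn (fun n => psi n.+1)); rewrite -cvg_shiftS/=.
have -> : (fun n => x n.+1) = v \- (fun n => psi n.+1).
  by apply/funext => n; rewrite /v /= addrK.
exact: cvgB.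
Qed.

(** The real and imaginary parts converge by monotonicity, and telescoping
    bounds the distance to any later term by psi N. *)
Lemma majorized_limn (u : nat -> R[i]) :
    (forall n, (0 < n)%N -> nrm (u n.+1 - u n) <= psi n - psi n.+1) ->
  forall N, (0 < N)%N -> nrm (limn u - u N) <= psi N.
Proof.
move=> upsi N N0.
have cRe : cvgn (fun n => complex.Re (u n)).
  apply: majorized_cvg_real => n n0; rewrite -ReB.
  exact: le_trans (normRe_le _) (upsi n n0).
have cIm : cvgn (fun n => complex.Im (u n)).
  apply: majorized_cvg_real => n n0; rewrite -ImB.
  exact: le_trans (normIm_le _) (upsi n n0).
set a : R := limn (fun n => complex.Re (u n)) in cRe.
set b : R := limn (fun n => complex.Im (u n)) in cIm.
have near_lim (e : R) : 0 < e ->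
    \forall n \near \oo, nrm ((a +i* b) - u n) <= e.
  move=> e0; have e2 : 0 < e / 2 by rewrite divr_gt0.
  move/cvgrPdist_le: cRe => /(_ _ e2) cRe.
  move/cvgrPdist_le: cIm => /(_ _ e2) cIm.
  near=> n; apply: le_trans (normc_ReIm _) _; rewrite ReB ImB /=.
  by rewrite [e]splitr lerD//; near: n.
have -> : limn u = a +i* b.
  apply: cvg_lim; first exact: norm_hausdorff.
  apply/cvgrPdist_le => -[e1 e2] /andP[/= /eqP -> e0].
  near=> n; rewrite norm_normc lecR.
  by near: n; exact: near_lim.
have step m : nrm (u (N + m)%N - u N) <= psi N - psi (N + m)%N.
  elim: m => [|m IHm]; first by rewrite addn0 !subrr ComplexField.Normc.normc0.
  rewrite addnS -(subrK (u (N + m)%N) (u _.+1)) -addrA.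
  apply: le_trans (normcD_le _ _) _.
  have := upsi (N + m)%N; rewrite addn_gt0 N0 => /(_ isT); lra.
suff H (e : R) : 0 < e -> nrm ((a +i* b) - u N) <= psi N + e.
  exact/ler_addgt0Pr.
move=> e0.
have [m _ /(_ (N + m)%N)/= Hm] := near_lim e e0.
have {}Hm := Hm (leq_addl _ _).
rewrite -(subrK (u (N + m)%N) (a +i* b)) -addrA.
have := normcD_le ((a +i* b) - u (N + m)%N) (u (N + m)%N - u N).
have := psi0 (leq_trans N0 (leq_addr m N)); have := step m; lra.
Unshelve. all: by end_near.
Qed.

End Majorized.
End ComplexConvergence.

(** * Calculus of uniform logarithmic estimates *)

Section Estimates.
Context (R : realType) (S : set R[i]).
Implicit Types (f g : nat -> R[i] -> R[i]) (d e : nat).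

Local Notation nrm := (@ComplexField.Normc.normc R).
Local Notation L := (logp R).

Definition log_bounded d f := exists2 M : R, 0 <= M &
  forall N s, (0 < N)%N -> S s -> nrm (f N s) <= M * L N ^+ d.

(** An error term O(L_N^(d-1) / N); multiplying by L_N instead of lowering the
    exponent makes the definition meaningful for d = 0 as well, where it is
    the right one for differences that vanish. *)
Definition log_small d f := exists2 M : R, 0 <= M &
  forall N s, (0 < N)%N -> S s -> nrm (f N s) * L N <= M * (L N ^+ d / N%:R).

Lemma logpX_ge0 N d : 0 <= L N ^+ d.
Proof. by rewrite exprn_ge0// ltW// logp_gt0. Qed.

Lemma log_small_bounded d f : log_small d f -> log_bounded d f.
Proof.
move=> [M M0 H]; exists M => // N s N0 Ss.
have l1 := logp_ge1 R N.
apply: le_trans (ler_peMr (normc_ge0 _) l1) _; apply: le_trans (H N s N0 Ss) _.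
rewrite ler_wpM2l// ler_piMr ?logpX_ge0// invf_le1 ?ler1n// ltr0n//.
Qed.

Lemma eq_log_small d f g : log_small d f ->
  (forall N s, (0 < N)%N -> S s -> f N s = g N s) -> log_small d g.
Proof.
by move=> [M M0 H] fg; exists M => // N s N0 Ss; rewrite -fg//; exact: H.
Qed.

Lemma eq_log_bounded d f g : log_bounded d f ->
  (forall N s, (0 < N)%N -> S s -> f N s = g N s) -> log_bounded d g.
Proof.
by move=> [M M0 H] fg; exists M => // N s N0 Ss; rewrite -fg//; exact: H.
Qed.

Lemma log_bounded_le d e f : (d <= e)%N -> log_bounded d f -> log_bounded e f.
Proof.
move=> de [M M0 H]; exists M => // N s N0 Ss; apply: le_trans (H N s N0 Ss) _.
by rewrite ler_wpM2l// ler_weXn2l// logp_ge1.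
Qed.

Lemma log_small_le d e f : (d <= e)%N -> log_small d f -> log_small e f.
Proof.
move=> de [M M0 H]; exists M => // N s N0 Ss; apply: le_trans (H N s N0 Ss) _.
apply: ler_wpM2l => //; apply: ler_wpM2r; first by rewrite invr_ge0.
by rewrite ler_weXn2l// logp_ge1.
Qed.

Lemma log_bounded_cst d c : log_bounded d (fun _ _ => c).
Proof.
exists (nrm c) => [|N s _ _]; first exact: normc_ge0.
by rewrite ler_peMr ?normc_ge0// exprn_ege1// logp_ge1.
Qed.

Lemma log_small0 d : log_small d (fun _ _ => 0).
Proof.
by exists 0 => // N s _ _; rewrite ComplexField.Normc.normc0 !mul0r.
Qed.

Lemma log_boundedD d f g : log_bounded d f -> log_bounded d g ->
  log_bounded d (fun N s => f N s + g N s).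
Proof.
move=> [M M0 Hf] [M' M'0 Hg]; exists (M + M') => [|N s N0 Ss].
  exact: addr_ge0.
rewrite mulrDl; apply: le_trans (normcD_le _ _) _.
by apply: lerD; [exact: Hf|exact: Hg].
Qed.

Lemma log_smallD d f g : log_small d f -> log_small d g ->
  log_small d (fun N s => f N s + g N s).
Proof.
move=> [M M0 Hf] [M' M'0 Hg]; exists (M + M') => [|N s N0 Ss].
  exact: addr_ge0.
rewrite mulrDl; apply: le_trans (lerD (Hf N s N0 Ss) (Hg N s N0 Ss)).
rewrite -mulrDl ler_wpM2r ?normcD_le// ltW// logp_gt0//.
Qed.

Lemma log_boundedM d e f g : log_bounded d f -> log_bounded e g ->
  log_bounded (d + e) (fun N s => f N s * g N s).
Proof.
move=> [M M0 Hf] [M' M'0 Hg]; exists (M * M') => [|N s N0 Ss].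
  exact: mulr_ge0.
rewrite ComplexField.Normc.normcM exprD mulrACA.
by apply: ler_pM; rewrite ?normc_ge0//; [exact: Hf|exact: Hg].
Qed.

Lemma log_smallM d e f g : log_small d f -> log_bounded e g ->
  log_small (d + e) (fun N s => f N s * g N s).
Proof.
move=> [M M0 Hf] [M' M'0 Hg]; exists (M * M') => [|N s N0 Ss].
  exact: mulr_ge0.
rewrite ComplexField.Normc.normcM exprD mulrAC [L N ^+ d * _ / _]mulrAC mulrACA.
apply: ler_pM; rewrite ?normc_ge0//; [|exact: Hf|exact: Hg].
by rewrite mulr_ge0 ?normc_ge0// ltW// logp_gt0.
Qed.

Lemma log_small_sum d (I : eqType) (r : seq I) (f : I -> nat -> R[i] -> R[i]) :
    (forall i, i \in r -> log_small d (f i)) ->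
  log_small d (fun N s => \sum_(i <- r) f i N s).
Proof.
elim: r => [_|i r IHr H].
  by apply: eq_log_small (log_small0 d) _ => N s _ _; rewrite big_nil.
apply: eq_log_small (log_smallD (H i (mem_head i r)) (IHr _)) _.
  by move=> j jr; apply: H; rewrite inE jr orbT.
by move=> N s _ _; rewrite big_cons.
Qed.

Lemma log_bounded_sum d (I : eqType) (r : seq I)
    (f : I -> nat -> R[i] -> R[i]) :
    (forall i, i \in r -> log_bounded d (f i)) ->
  log_bounded d (fun N s => \sum_(i <- r) f i N s).
Proof.
elim: r => [_|i r IHr H].
  by apply: eq_log_bounded (log_bounded_cst d 0) _ => N s _ _; rewrite big_nil.
apply: eq_log_bounded (log_boundedD (H i (mem_head i r)) (IHr _)) _.
  by move=> j jr; apply: H; rewrite inE jr orbT.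
by move=> N s _ _; rewrite big_cons.
Qed.

(** f g - f' g' = (f - f') g + f' (g - g'). *)
Lemma log_small_mulB d e f f' g g' :
    log_small d (fun N s => f N s - f' N s) -> log_bounded d f' ->
    log_small e (fun N s => g N s - g' N s) -> log_bounded e g' ->
  log_small (d + e) (fun N s => f N s * g N s - f' N s * g' N s).
Proof.
move=> ff bf gg bg.
have bg' : log_bounded e g.
  by apply: eq_log_bounded (log_boundedD (log_small_bounded gg) bg) _ => *;
    rewrite subrK.
have gf := log_smallM gg bf; rewrite addnC in gf.
apply: eq_log_small (log_smallD (log_smallM ff bg') gf) _ => N s _ _ /=.
by ring.
Qed.

Lemma log_small_expB d l f f' :
    log_small d (fun N s => f N s - f' N s) -> log_bounded d f' ->
  log_small (l * d) (fun N s => f N s ^+ l - f' N s ^+ l)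
  /\ log_bounded (l * d) (fun N s => f' N s ^+ l).
Proof.
move=> ff bf; elim: l => [|l [IHs IHb]].
  split; last exact: log_bounded_cst.
  by apply: eq_log_small (log_small0 _) _ => N s _ _; rewrite !expr0 subrr.
rewrite mulSn; split.
  apply: eq_log_small (log_small_mulB ff bf IHs IHb) _ => N s _ _.
  by rewrite !exprS.
by apply: eq_log_bounded (log_boundedM bf IHb) _ => N s _ _; rewrite exprS.
Qed.

Lemma log_small_opp d f : (forall s, S s -> S (- s)) -> log_small d f ->
  log_small d (fun N s => f N (- s)).
Proof.
by move=> SN [M M0 H]; exists M => // N s N0 Ss; apply: H => //; exact: SN.
Qed.

Lemma log_bounded_opp d f : (forall s, S s -> S (- s)) -> log_bounded d f ->
  log_bounded d (fun N s => f N (- s)).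
Proof.
by move=> SN [M M0 H]; exists M => // N s N0 Ss; apply: H => //; exact: SN.
Qed.

End Estimates.

(** * Truncated zeta values *)

Section TruncatedZeta.
Context (R : realType).
Implicit Types (k w : seq nat) (s : R[i]).

Local Notation nrm := (@ComplexField.Normc.normc R).
Local Notation L := (logp R).

Definition zeta_factor s a n : R[i] := ((n%:R + s) ^+ a)^-1.

Definition trunc_zeta k N s : R[i] := nsum (zeta_factor s) N k 1.

Lemma zeta_factorD s a b n :
  zeta_factor s (a + b) n = zeta_factor s a n * zeta_factor s b n.
Proof. by rewrite /zeta_factor exprD invfM. Qed.

Lemma nested_sum_trunc_zeta N k s : (0 < N)%N ->
  nested_sum 1 N.-1 k s = trunc_zeta k N s.
Proof.
case: N => // N _; rewrite nested_sumE /trunc_zeta.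
have := nsum_shift 1 (zeta_factor s) N k 0; rewrite addn1 add0n => ->.
apply: eq_nsum => a n _ _.
by rewrite /zeta_factor rmorphD/= addn1 -natr1 [1 + _]addrC.
Qed.

(** The real part of n + s is at least n - 1/2. *)
Lemma normc_shift_ge s n : strip R s -> (0 < n)%N ->
  n%:R / 2 <= nrm (n%:R + s).
Proof.
move=> Ss n0; apply: le_trans (normRe_le _).
have -> : complex.Re (n%:R + s) = n%:R + complex.Re s.
  case: s {Ss} => a' b; rewrite -[in LHS](rmorph_nat (real_complex R)).
  by [].
have : `|complex.Re s| < 2^-1 by exact: Ss.
have n1 : 1 <= n%:R :> R by rewrite ler1n.
rewrite ltr_norml => /andP[s1 s2]; apply: le_trans (ler_norm _); lra.
Qed.

Lemma zeta_factor_le s a n : strip R s -> (0 < n)%N ->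
  nrm (zeta_factor s a n) <= (2 / n%:R) ^+ a.
Proof.
move=> Ss n0; have n0' : (0 : R) < n%:R by rewrite ltr0n.
have p0 : 0 < n%:R / 2 :> R by rewrite divr_gt0.
have H := normc_shift_ge Ss n0.
rewrite ComplexField.Normc.normcV normcXn -exprVn.
apply: lerXn2r; rewrite ?nnegrE ?invr_ge0 ?normc_ge0 ?divr_ge0//.
rewrite -[2 / _]invf_div lef_pV2 ?posrE//.
exact: lt_le_trans H.
Qed.

Lemma zeta_factor_le1 s a n : strip R s -> (0 < n)%N -> (0 < a)%N ->
  nrm (zeta_factor s a n) <= 2 ^+ a * n%:R^-1.
Proof.
move=> Ss n0 a0; apply: le_trans (zeta_factor_le a Ss n0) _.
rewrite exprMn ler_wpM2l ?exprn_ge0// -[leRHS]expr1.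
by rewrite ler_wiXn2l ?invr_ge0// invf_le1 ?ler1n ?ltr0n.
Qed.

Lemma zeta_factor_le2 s a n : strip R s -> (0 < n)%N -> (1 < a)%N ->
  nrm (zeta_factor s a n) <= 2 ^+ a * 2 / (n%:R * n.+1%:R).
Proof.
move=> Ss n0 a1; apply: le_trans (zeta_factor_le a Ss n0) _.
rewrite exprMn -mulrA ler_wpM2l ?exprn_ge0//.
apply: (@le_trans _ _ (n%:R^-1 ^+ 2)).
  by rewrite ler_wiXn2l ?invr_ge0// invf_le1 ?ler1n ?ltr0n.
have n0' : (0 : R) < n%:R by rewrite ltr0n.
rewrite expr2 invfM mulrCA ler_wpM2l ?invr_ge0//.
rewrite -[2 / _]invf_div lef_pV2 ?posrE ?divr_gt0//.
have : 1 <= n%:R :> R by rewrite ler1n.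
rewrite -natr1; lra.
Qed.

Lemma normc_sum_le m M (F : nat -> R[i]) :
  nrm (\sum_(m <= n < M) F n) <= \sum_(m <= n < M) nrm (F n).
Proof.
elim/big_ind2: _ => [|x a y b xa yb|//].
  by rewrite ComplexField.Normc.normc0.
exact: le_trans (normcD_le _ _) (lerD xa yb).
Qed.

Lemma trunc_zeta_le k N s : is_index k -> strip R s ->
  nrm (trunc_zeta k N s) <= 2 ^+ weight k * L N ^+ size k.
Proof.
move=> ik Ss; elim/last_ind: k N ik => [|k a IHk] N.
  by rewrite [trunc_zeta _ _ _]/(1) ComplexField.Normc.normc1 !expr0 mulr1.
rewrite /is_index all_rcons => /andP[a0 ik].
rewrite /trunc_zeta nsum_rcons size_rcons /weight -cats1 sumn_cat /= addn0.
apply: le_trans (normc_sum_le _ _ _) _.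
have : \sum_(1 <= n < N) nrm (zeta_factor s a n * nsum (zeta_factor s) n k 1)
    <= \sum_(1 <= n < N) 2 ^+ (sumn k + a) * L N ^+ size k * n%:R^-1.
  rewrite big_nat [leRHS]big_nat; apply: ler_sum => n /andP[n0 nN].
  rewrite ComplexField.Normc.normcM exprD.
  apply: (@le_trans _ _ ((2 ^+ a * n%:R^-1) * (2 ^+ sumn k * L N ^+ size k))).
    apply: ler_pM; rewrite ?normc_ge0 ?zeta_factor_le1//.
    apply: le_trans (IHk n ik) _; rewrite ler_wpM2l ?exprn_ge0//.
    by rewrite lerXn2r ?nnegrE ?logp_le ?(ltW (logp_gt0 _ _)) ?(ltnW nN).
  by rewrite le_eqVlt; apply/orP; left; apply/eqP; ring.
move=> /le_trans; apply; rewrite -mulr_sumr exprSr mulrA.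
by rewrite ler_wpM2l ?harmonic_le_logp// mulr_ge0 ?exprn_ge0// ltW// logp_gt0.
Qed.

Lemma log_bounded_trunc_zeta (S : set R[i]) k : S `<=` strip R -> is_index k ->
  log_bounded S (size k) (trunc_zeta k).
Proof.
move=> Sstrip ik; exists (2 ^+ weight k) => [|N s _ Ss]; first exact: exprn_ge0.
by apply: trunc_zeta_le => //; exact: Sstrip.
Qed.

(** The increment of Z_n(k, a) is (n + s)^(-a) Z_n(k), hence
    O(L_n^d / n^2) when a >= 2, where d is the depth of k. *)
Lemma log_small_zeta (S : set R[i]) k : S `<=` strip R -> admissible k ->
  log_small S (size k) (fun N s => zeta k s - trunc_zeta k N s).
Proof.
move=> Sstrip /andP[]; elim/last_ind: k => [_ _|k a _].
  apply: eq_log_small (log_small0 _ _) _ => N s _ _.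
  rewrite /zeta (_ : (fun N => _) = (fun=> 1)); last first.
    by apply/funext => n; rewrite nested_sumE.
  by rewrite lim_cst ?subrr.
rewrite /is_index all_rcons last_rcons => /andP[a0 ik].
have -> : rcons k a == [::] = false by case: (k).
move=> /= a1; rewrite size_rcons.
have [psi [A A0 H]] := log_tail R (size k).
pose c : R := 2 ^+ a * 2 * 2 ^+ weight k.
have c0 : 0 <= c by rewrite !mulr_ge0 ?exprn_ge0.
exists (c * A) => [|N s N0 Ss]; first exact: mulr_ge0.
have := @majorized_limn R (fun n => c * psi n) _
  (fun n => nested_sum 1 n.-1 (rcons k a) s).
rewrite -/(zeta _ _) => M.
have {}M : nrm (zeta (rcons k a) s - trunc_zeta (rcons k a) N s) <= c * psi N.
  rewrite -nested_sum_trunc_zeta//; apply: M => // n n0.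
    by have [p0 _ _] := H n n0; exact: mulr_ge0.
  rewrite !nested_sum_trunc_zeta// /trunc_zeta !nsum_rcons big_nat_recr//=.
  rewrite [X in X - _]addrC addrK ComplexField.Normc.normcM -mulrBr.
  have [_ _ pd] := H n n0.
  apply: le_trans (ler_wpM2l c0 pd).
  have -> : c * (L n ^+ size k / (n%:R * n.+1%:R)) =
     (2 ^+ a * 2 / (n%:R * n.+1%:R)) * (2 ^+ weight k * L n ^+ size k).
    by rewrite /c; ring.
  apply: ler_pM; rewrite ?normc_ge0 ?trunc_zeta_le ?zeta_factor_le2//;
    exact: Sstrip.
have [_ pA _] := H N N0.
have -> : c * A * (L N ^+ (size k).+1 / N%:R) =
    c * (A * (L N ^+ size k / N%:R)) * L N by rewrite exprS; ring.
apply: ler_wpM2r; first by rewrite ltW// logp_gt0.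
by apply: le_trans M _; rewrite ler_wpM2l.
Qed.

End TruncatedZeta.

(** * Regularized and truncated zeta values *)

Section RegularizedZeta.
Context (R : realType).
Implicit Types (k w : seq nat) (s : R[i]).

Local Notation nrm := (@ComplexField.Normc.normc R).
Local Notation L := (logp R).
Local Notation H := (@harmonic_fun R).
Local Notation T := (harmonic_sum R).

Lemma log_small_zeta_lin (S : set R[i]) d (D : word_span) : S `<=` strip R ->
    (forall w, w \in dom D -> admissible w /\ (size w <= d)%N) ->
  log_small S d
    (fun N s => zeta_lin D s - word_eval (fun w => trunc_zeta w N s) D) /\
  log_bounded S d (fun N s => word_eval (fun w => trunc_zeta w N s) D).
Proof.
move=> Sstrip DP; split.
  pose f w (N : nat) s := (zeta w s - trunc_zeta w N s) * ratr (coeff w D).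
  apply: (@eq_log_small _ _ _ (fun N s => \sum_(w <- dom D) f w N s)).
    apply: log_small_sum => w /DP[aw wd]; rewrite -[d]addn0.
    apply: log_smallM; last exact: log_bounded_cst.
    exact: log_small_le wd (log_small_zeta Sstrip aw).
  move=> N s _ _; rewrite /word_eval -sumrB; apply: eq_bigr => w _.
  by rewrite /f mulrBl ![_ * ratr _]mulrC.
apply: log_bounded_sum => w /DP[/andP[iw _] wd]; rewrite -[d]add0n.
apply: log_boundedM; first exact: log_bounded_cst.
exact: log_bounded_le wd (log_bounded_trunc_zeta Sstrip iw).
Qed.

(** T_N minus the N-th partial sum of H(s) is exactly Z_N(1; s), and the terms
    of H are s / (n (n + s)). *)
Lemma log_small_harmonic (S : set R[i]) (B : R) : S `<=` strip R ->
    (forall s, S s -> nrm s <= B) ->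
  log_small S 1 (fun N s => T N - H s - trunc_zeta [:: 1%N] N s).
Proof.
move=> Sstrip SB; pose c : R := 4 * `|B|.
have c0 : 0 <= c by rewrite mulr_ge0.
exists c => // N s N0 Ss; have ss := Sstrip s Ss.
have sB : nrm s <= `|B| by apply: le_trans (SB s Ss) (ler_norm _).
pose h n := \sum_(1 <= i < n) (i%:R^-1 - (i%:R + s)^-1) : R[i].
have -> : T N - H s - trunc_zeta [:: 1%N] N s = - (H s - h N).
  rewrite /h sumrB /trunc_zeta /= /zeta_factor.
  under [X in _ - X]eq_bigr do rewrite mulr1 expr1.
  rewrite /harmonic_sum; ring.
rewrite normcN expr1 mulrCA mulrC; apply: ler_wpM2l.
  by rewrite ltW// logp_gt0.
apply: (@majorized_limn R (fun n => c / n%:R)) => // n n0.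
  by rewrite divr_ge0.
have n0' : (0 : R) < n%:R by rewrite ltr0n.
rewrite big_nat_recr//= [X in X - _]addrC addrK.
have ns0 : n%:R + s != 0.
  apply/eqP => ns0; have := normc_shift_ge ss n0.
  rewrite ns0 ComplexField.Normc.normc0 leNgt divr_gt0//.
have nC : (n%:R : R[i]) != 0 by rewrite pnatr_eq0 -lt0n.
have -> : n%:R^-1 - (n%:R + s)^-1 = s * n%:R^-1 * zeta_factor s 1 n :> R[i].
  by rewrite /zeta_factor; field; rewrite ns0 nC.
rewrite !ComplexField.Normc.normcM.
have -> : nrm n%:R^-1 = n%:R^-1.
  rewrite ComplexField.Normc.normcV -(rmorph_nat (real_complex R)) normc_real.
  by rewrite ger0_norm.
have -> : c / n%:R - c / n.+1%:R = `|B| * n%:R^-1 * (4 / n.+1%:R).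
  rewrite /c -natr1; field; by rewrite !gt_eqF// addr_gt0.
apply: ler_pM; rewrite ?mulr_ge0 ?normc_ge0 ?invr_ge0 ?ler_wpM2r ?invr_ge0//.
apply: le_trans (zeta_factor_le 1 ss n0) _; rewrite expr1.
rewrite ler_pdivrMr// mulrAC ler_pdivlMr//.
have : 1 <= n%:R :> R by rewrite ler1n.
rewrite -natr1; lra.
Qed.

(** The term of index l combines depths r - l and l, hence the total depth r. *)
Lemma log_small_zeta_reg (S : set R[i]) (B : R) k : S `<=` strip R ->
    (forall s, S s -> nrm s <= B) -> is_index k ->
  log_small S (size k)
    (fun N s => zeta_reg k (T N - H s) s - trunc_zeta k N s).
Proof.
move=> Sstrip SB ik; have [uP E] := stuffle_decompP ik.
set u := stuffle_decomp k in uP E.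
pose F N s w := trunc_zeta w N s.
pose f (l : 'I_(size k).+1) N s :=
  zeta_lin (u l) s * (T N - H s) ^+ l
  - word_eval (F N s) (u l) * (trunc_zeta [:: 1%N] N s) ^+ l.
apply: (@eq_log_small _ _ _ (fun N s => \sum_l f l N s)).
  apply: log_small_sum => l _.
  have lk : (l <= size k)%N by rewrite -ltnS.
  rewrite -[size k](subnK lk) -[X in (_ + X)%N]muln1.
  have [us ub] := log_small_zeta_lin Sstrip (uP l).
  have [Xs Xb] := log_small_expB l (log_small_harmonic Sstrip SB)
    (log_bounded_trunc_zeta Sstrip (isT : is_index [:: 1%N])).
  exact: log_small_mulB us ub Xs Xb.
move=> N s _ _; rewrite /f sumrB; congr (_ - _).
have FM v w : word_eval (F N s) (stuffle_word v w) = F N s v * F N s w.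
  by apply: nsum_stuffle => a b n; exact: zeta_factorD.
rewrite -[trunc_zeta k N s](word_evalU (F N s)) E.
rewrite (big_morph _ (word_evalD (F N s)) (word_eval0 (F N s))).
by apply: eq_bigr => l _; rewrite word_eval_stuffle// word_eval_pow.
Qed.

End RegularizedZeta.

(** * Splitting the multitangent sum at zero *)

Section MultitangentCut.
Context (R : realType).
Implicit Types (k : seq nat) (s : R[i]).

(** The first sum collects the chains that avoid 0, the second those whose
    entry of index j is 0. *)
Lemma multitangent_cut N k s : (0 < N)%N ->
  multitangent N k s =
    \sum_(j < (size k).+1) (-1) ^+ weight (take j k)
      * trunc_zeta (rev (take j k)) N (- s) * trunc_zeta (drop j k) N s
    + \sum_(j < size k) (-1) ^+ weight (take j k) / s ^+ nth 0%N k j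
      * trunc_zeta (rev (take j k)) N (- s) * trunc_zeta (drop j.+1 k) N s.
Proof.
case: N => // M _; rewrite /multitangent nested_sumE.
set G := fun a n => _.
have neg v : nsum G M v 0 =
    (-1) ^+ weight v * trunc_zeta (rev v) M.+1 (- s).
  rewrite nsum_rev// subn0.
  have -> : weight v = weight (rev v) by rewrite /weight sumn_rev.
  rewrite -nsumZ.
  have := nsum_shift 1 (fun a n => (-1) ^+ a * zeta_factor (- s) a n)
    M (rev v) 0.
  rewrite addn1 add0n => ->.
  apply: eq_nsum => a n _ /andP[_ nM]; rewrite /G /zeta_factor.
  have -> : (1 - M.+1%:Z + (M - n.+1)%N%:Z)%R = - (n + 1)%N%:Z by lia.
  rewrite rmorphN/= -[- _ + s]opprK opprD opprK [in LHS]exprNn.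
  by rewrite invfM invr_sign.
have pos v : nsum G (M.+1.*2).-1 v M.+1 = trunc_zeta v M.+1 s.
  have -> : (M.+1.*2).-1 = (M.+1 + M)%N by lia.
  have := nsum_shift M G M.+1 v 1; rewrite add1n => ->.
  apply: eq_nsum => a n _ _.
  rewrite /G /zeta_factor.
  by have -> : (1 - M.+1%:Z + (n + M)%N%:Z)%R = n%:Z by lia.
(* The summation variable M of G stands for the integer 0. *)
rewrite (@nsum_cut _ M); last by lia.
rewrite big_ord_recr [X in _ = X + _]big_ord_recr/=.
rewrite drop_size take_size -[RHS]addrA [X in _ = _ + X]addrC [RHS]addrA.
congr (_ + _); last by rewrite neg.
rewrite -big_split/=; apply: eq_bigr => j _.
rewrite (drop_nth 0%N)// nsum_ltn; last by lia.
rewrite !pos neg -drop_nth//.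
have -> : G (nth 0%N k j) M = (s ^+ nth 0%N k j)^-1.
  rewrite /G; have -> : (1 - M.+1%:Z + M%:Z)%R = 0 by lia.
  by rewrite mulr0z add0r.
ring.
Qed.

End MultitangentCut.

(** * Uniformity on compact sets *)

Section CompactParameters.
Context (R : realType).
Implicit Types (s : R[i]).

Local Notation nrm := (@ComplexField.Normc.normc R).

(** A symmetric domain, as the negative block is evaluated at -s. *)
Definition strip_annulus (delta B : R) : set R[i] :=
  [set s | strip R s /\ delta <= nrm s <= B].

Lemma strip_annulusN delta B s :
  strip_annulus delta B s -> strip_annulus delta B (- s).
Proof.
move=> [ss sB]; split; last by rewrite normcN.
by move: ss; rewrite /strip /=; case: s {sB} => a b /=; rewrite normrN.
Qed.

Lemma normc_continuous : continuous nrm.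
Proof.
move=> s; apply: (@cvgrPdist_le _ _ _ (nbhs s) _ nrm (nrm s)).2 => e e0.
apply/nbhs_ballP.
exists e%:C => /=; first by rewrite ltcR.
move=> t; rewrite -ball_normE /= norm_normc ltcR => /ltW; apply: le_trans.
have st := normcD_le (s - t) t; have ts := normcD_le (t - s) s.
rewrite subrK in st; rewrite subrK -[nrm (t - s)]normcN opprB in ts.
by rewrite ler_norml; apply/andP; split; lra.
Qed.

Lemma compact_strip_annulus (K : set R[i]) : compact K ->
  K `<=` strip R `\` [set 0] ->
  exists delta B, 0 < delta /\ K `<=` strip_annulus delta B.
Proof.
move=> cK KL.
have cA : compact (nrm @` K).
  apply: continuous_compact => //.
  by apply: continuous_subspaceT; exact: normc_continuous.
have [B [_ HB]] := compact_bounded cA.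
have A0 : ~ (nrm @` K) 0.
  by move=> [s Ks /ComplexField.Normc.eq0_normc s0]; have [_] := KL s Ks.
have oA : open (~` (nrm @` K)).
  by rewrite openC; apply: compact_closed => //; exact: Rhausdorff.
have /nbhs_ballP[d /= d0 Hd] := open_nbhs_nbhs (conj oA A0).
exists d, (`|B| + 1); split=> // s Ks; split; first by case: (KL s Ks).
apply/andP; split.
  rewrite leNgt; apply/negP => sd; apply: (Hd (nrm s)); last by exists s.
  by rewrite /ball /= sub0r normrN ger0_norm ?normc_ge0.
have B1 : B < `|B| + 1 by rewrite (le_lt_trans (ler_norm B))// ltrDl.
have /= := HB _ B1 (nrm s); rewrite ger0_norm ?normc_ge0//.
by apply; exists s.
Qed.

End CompactParameters.

(** The two exact expressions are compared term by term; the terms of the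
    second sum have total depth r - 1 only. *)
Lemma log_small_reg_multitangent (R : realType) (delta B : R) k :
    0 < delta -> is_index k ->
  log_small (strip_annulus delta B) (size k)
    (fun N s => reg_multitangent k (harmonic_sum R N) s - multitangent N k s).
Proof.
move=> d0 ik; set S := strip_annulus delta B.
have Sstrip : S `<=` strip R by move=> s [].
have SB s : S s -> ComplexField.Normc.normc s <= B by move=> [_ /andP[]].
have SN s : S s -> S (- s) by exact: strip_annulusN.
pose Z v N s := zeta_reg v (harmonic_sum R N - harmonic_fun s) s.
have Zs v : is_index v ->
    log_small S (size v) (fun N s => Z v N s - trunc_zeta v N s).
  by move=> iv; exact: log_small_zeta_reg Sstrip SB iv.
have Tb v : is_index v -> log_bounded S (size v) (trunc_zeta v).
  by move=> iv; exact: log_bounded_trunc_zeta Sstrip iv.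
have iT j : is_index (rev (take j k)).
  rewrite /is_index all_rev; apply/allP => x /mem_take; exact: (allP ik).
have iD j : is_index (drop j k).
  by apply/allP => x /mem_drop; exact: (allP ik).
have prod_small i j (g : R[i] -> R[i]) : (i <= j)%N -> (i <= size k)%N ->
    log_bounded S 0 (fun _ s => g s) ->
  log_small S (size k) (fun N s =>
    g s * Z (rev (take i k)) N (- s) * Z (drop j k) N s
    - g s * trunc_zeta (rev (take i k)) N (- s) * trunc_zeta (drop j k) N s).
  move=> ij ilek gb.
  have := log_small_mulB (log_small_opp SN (Zs _ (iT i)))
    (log_bounded_opp SN (Tb _ (iT i))) (Zs _ (iD j)) (Tb _ (iD j)).
  rewrite size_rev size_takel// size_drop => /log_smallM/(_ gb) sm.
  apply: eq_log_small (log_small_le _ sm) _; first by lia.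
  by move=> N s _ _; ring.
pose sg j : R[i] := (-1) ^+ weight (take j k).
(* The factors s^(-k_j) are bounded because |s| >= delta. *)
have inv_bounded a : log_bounded S 0 (fun _ s => (s ^+ a)^-1).
  exists (delta^-1 ^+ a) => [|N s _ [_ /andP[ds _]]].
    by rewrite exprn_ge0// invr_ge0 ltW.
  have s0 := lt_le_trans d0 ds.
  rewrite mulr1 ComplexField.Normc.normcV normcXn -exprVn.
  rewrite lerXn2r ?nnegrE ?invr_ge0 ?normc_ge0 ?(ltW d0)//.
  by rewrite lef_pV2.
have := log_smallD
  (log_small_sum (fun (j : 'I_(size k).+1) (_ : j \in index_enum _) =>
    prod_small j j (fun=> sg j) (leqnn j) (leq_ord j)
      (log_bounded_cst S 0 (sg j))))
  (log_small_sum (fun (j : 'I_(size k)) (_ : j \in index_enum _) =>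
    prod_small j j.+1 (fun s => sg j / s ^+ nth 0%N k j) (leqnSn j)
      (ltnW (ltn_ord j))
      (log_boundedM (log_bounded_cst S 0 (sg j)) (inv_bounded (nth 0%N k j))))).
move=> /eq_log_small; apply => N s N0 _.
rewrite multitangent_cut// !sumrB /reg_multitangent /Z /sg.
by rewrite opprD addrACA.
Qed.

Unset Implicit Arguments.
Set Strict Implicit.
Set Printing Implicit Defensive.

Theorem theorem3p4 (R : realType) (k : seq nat) (hk : is_index k)
    (K : set R[i]) (Kcompact : compact K)
    (KL : K `<=` strip R `\` [set 0]) :
  exists M : R, \forall N \near \oo, forall s : R[i], K s ->
    `|multitangent N k s - reg_multitangent k (harmonic_sum R N) s|
      <= (M * ((1 + ln (N%:R : R)) ^ ((size k)%:Z - 1) / N%:R))%:C.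
Proof.
have [delta [B [d0 KS]]] := compact_strip_annulus Kcompact KL.
have [M M0 HM] := log_small_reg_multitangent B d0 hk.
exists M; exists 1%N => // N /= N0 s /KS Ss.
rewrite distrC norm_normc lecR -/(logp R N).
(* The exponent r - 1 is reached by dividing by L_N, also when r = 0. *)
have L0 := logp_gt0 R N.
rewrite -(ler_pM2r L0); apply: le_trans (HM N s N0 Ss) _.
rewrite expfzDr ?gt_eqF// -exprnP exprN1.
by rewrite -!mulrA [_^-1 * (_ * _)]mulrCA mulVf ?gt_eqF// mulr1.
Qed.
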